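(* Let $0\le l\le k$ be integers. Let $\mathbb{F}^k$ be the free group on generators $f_1,\dots,f_k$, and let $\mathbb{FQ}^k_l\subset\mathbb{F}^k$ be the union of $\{\mathbf{1}\}$ and the conjugacy classes of $f_1,\dots,f_l$, regarded as a PMQ so that $(\mathbb{FQ}^k_l,\mathbb{F}^k)$ is a PMQ-group pair. Let $(\mathcal{Q},G,\mathfrak{e},\mathfrak{r})$ be a PMQ-group pair, let $a_1,\dots,a_l\in\mathcal{Q}$ and let $g_{l+1},\dots,g_k\in G$. Then there are unique maps $\varphi\colon\mathbb{F}^k\to G$ of groups and $\psi\colon\mathbb{FQ}^k_l\to\mathcal{Q}$ of PMQs such that $\psi(f_i)=a_i$ for all $1\le i\le l$, $\varphi(f_i)=g_i$ for all $l+1\le i\le k$, and $(\psi,\varphi)\colon(\mathbb{FQ}^k_l,\mathbb{F}^k)\to(\mathcal{Q},G)$ is a map of PMQ-group pairs. (In other words, $(\mathbb{FQ}^k_l,\mathbb{F}^k)$ is a free object in the category of PMQ-group pairs, on $l$ generators of PMQ-type and $k-l$ generators of group-type.)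
   Context: A quandle (with unit) is a set $\mathcal{Q}$ with an element $\mathbf{1}\in\mathcal{Q}$ (unit) and a binary operation $(a,b)\mapsto a^b$ (conjugation) such that: $(-)^a\colon\mathcal{Q}\to\mathcal{Q}$ is bijective for all $a$; $\mathbf{1}^a=\mathbf{1}$ and $a^{\mathbf{1}}=a$; $a^a=a$; $(a^b)^c=(a^c)^{(b^c)}$ for all $a,b,c$. A partial monoid is a set $M$ with an element $\mathbf{1}$, a subset $D\subseteq M\times M$ and a map $D\to M$, $(a,b)\mapsto ab$ (one says $ab$ is defined if $(a,b)\in D$), such that $\mathbf{1}a$ and $a\mathbf{1}$ are defined and equal to $a$, and for all $a,b,c$: ($ab$ and $(ab)c$ are defined) if and only if ($bc$ and $a(bc)$ are defined), in which case $(ab)c=a(bc)$. A PMQ is a set $\mathcal{Q}$ that is both a quandle and a partial monoid with the same unit, such that for all $a,b,c$: (1) $ab$ is defined iff $b(a^b)$ is defined, and then $ab=b(a^b)$; (2) $a^{(bc)}=(a^b)^c$ whenever $bc$ is defined; (3) $ab$ is defined iff $(a^c)(b^c)$ is defined, and then $(ab)^c=(a^c)(b^c)$. A map of PMQs is a map of sets preserving unit, conjugation and defined products. Every group is a PMQ with its full product and $a^b=b^{-1}ab$. A PMQ-group pair $(\mathcal{Q},G,\mathfrak{e},\mathfrak{r})$ consists of a PMQ $\mathcal{Q}$, a group $G$, a map of PMQs $\mathfrak{e}\colon\mathcal{Q}\to G$ and a right action $\mathfrak{r}\colon G\to\mathrm{Aut}_{\mathrm{PMQ}}(\mathcal{Q})^{op}$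 of $G$ on $\mathcal{Q}$ by PMQ automorphisms such that $\mathfrak{r}(\mathfrak{e}(b))(a)=a^b$ for all $a,b\in\mathcal{Q}$ and $\mathfrak{e}(\mathfrak{r}(g)(a))=g^{-1}\mathfrak{e}(a)g$ for all $a\in\mathcal{Q}$, $g\in G$. A map of PMQ-group pairs $(\mathcal{Q},G,\mathfrak{e},\mathfrak{r})\to(\mathcal{Q}',G',\mathfrak{e}',\mathfrak{r}')$ is a pair $(\Psi,\Phi)$ of a map of PMQs $\Psi\colon\mathcal{Q}\to\mathcal{Q}'$ and a group homomorphism $\Phi\colon G\to G'$ with $\Phi\circ\mathfrak{e}=\mathfrak{e}'\circ\Psi$ and $\Psi\circ\mathfrak{r}(g)=\mathfrak{r}'(\Phi(g))\circ\Psi$ for all $g\in G$. The PMQ structure on $\mathbb{FQ}^k_l$: conjugation is $a^b=b^{-1}ab$ in $\mathbb{F}^k$, and the product $ab$ is defined if and only if the product in $\mathbb{F}^k$ lies in $\mathbb{FQ}^k_l$, in which case it is the product in $\mathbb{F}^k$ (in fact $ab$ is defined only if $a=\mathbf{1}$ or $b=\mathbf{1}$). The PMQ-group pair structure on $(\mathbb{FQ}^k_l,\mathbb{F}^k)$ is given by the inclusion $\mathbb{FQ}^k_l\subset\mathbb{F}^k$ and the right conjugation action of $\mathbb{F}^k$. *)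

(* Defs.v *)
From HB Require Import structures.
From mathcomp Require Import all_boot ssralg ssrint boolp.
(* After ssralg, so that [monoid_morphism] is the one on groups. *)
From mathcomp Require Import monoid.

Set Implicit Arguments.
Unset Strict Implicit.
Unset Printing Implicit Defensive.

Local Open Scope group_scope.

HB.mixin Record hasUnit Q := { qunit : Q }.
HB.structure Definition Unital := {Q of hasUnit Q}.

(* [qconj a b] is a^b. *)
HB.mixin Record isQuandle Q of hasUnit Q := {
  qconj : Q -> Q -> Q;
  qconj_bij : forall a, bijective (qconj^~ a);
  qconj1q : forall a, qconj qunit a = qunit;
  qconjq1 : forall a, qconj a qunit = a;
  qconjqq : forall a, qconj a a = a;
  qconjJ : forall a b c,
    qconj (qconj a b) c = qconj (qconj a c) (qconj b c)
}.

#[short(type="quandleType")]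
HB.structure Definition Quandle := {Q of hasUnit Q & isQuandle Q}.

(* A partial product D -> M, with D a subset of M * M, is encoded as
   [pmul : M -> M -> option M]: ab is defined, with value c, when
   [pmul a b = Some c], and undefined when [pmul a b = None].  An equation
   between options thus says that one side is defined iff the other one is,
   and that both then have the same value. *)
HB.mixin Record isPartialMonoid M of hasUnit M := {
  pmul : M -> M -> option M;
  pmul1q : forall a, pmul qunit a = Some a;
  pmulq1 : forall a, pmul a qunit = Some a;
  pmulA : forall a b c,
    obind (fun ab => pmul ab c) (pmul a b)
    = obind (fun bc => pmul a bc) (pmul b c)
}.

#[short(type="partialMonoidType")]
HB.structure Definition PartialMonoid := {M of hasUnit M & isPartialMonoid M}.

HB.mixin Record Quandle_PartialMonoid_isPMQ Q
    of Quandle Q & PartialMonoid Q := {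
  pmulC : forall a b : Q, pmul a b = pmul b (qconj a b);
  qconjM : forall a b c bc : Q,
    pmul b c = Some bc -> qconj a bc = qconj (qconj a b) c;
  pmulJ : forall a b c : Q,
    omap (qconj^~ c) (pmul a b) = pmul (qconj a c) (qconj b c)
}.

#[short(type="pmqType")]
HB.structure Definition PMQ :=
  {Q of Quandle Q & PartialMonoid Q & Quandle_PartialMonoid_isPMQ Q}.

Record is_pmq_map (Q Q' : pmqType) (f : Q -> Q') : Prop := IsPMQMap {
  pmq_map1 : f qunit = qunit;
  pmq_mapJ : forall a b, f (qconj a b) = qconj (f a) (f b);
  pmq_mapM : forall a b c, pmul a b = Some c -> pmul (f a) (f b) = Some (f c)
}.

Definition is_pmq_aut (Q : pmqType) (f : Q -> Q) : Prop :=
  is_pmq_map f /\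
  exists f' : Q -> Q, [/\ is_pmq_map f', cancel f f' & cancel f' f].

Definition group_pmq (G : groupType) : Type := G.

Section GroupPMQ.
Variable G : groupType.
Implicit Types a b c : G.

HB.instance Definition _ := hasUnit.Build (group_pmq G) (1 : G).

Fact group_qconj_bij b : bijective (fun a : G => a ^ b).
Proof. by exists (fun a => a ^ b^-1) => a; rewrite ?conjgK ?conjgKV. Qed.

Fact group_qconjgg a : a ^ a = a.
Proof. by rewrite conjgE mulKg. Qed.

HB.instance Definition _ := isQuandle.Build (group_pmq G)
  group_qconj_bij (@conj1g G) (@conjg1 G) group_qconjgg (@conjJg G).

Fact group_pmul1g a : Some (1 * a) = Some a. Proof. by rewrite mul1g. Qed.
Fact group_pmulg1 a : Some (a * 1) = Some a. Proof. by rewrite mulg1. Qed.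
Fact group_pmulA a b c :
  obind (fun ab => Some (ab * c)) (Some (a * b))
  = obind (fun bc => Some (a * bc)) (Some (b * c)).
Proof. by rewrite /= mulgA. Qed.

HB.instance Definition _ := isPartialMonoid.Build (group_pmq G)
  group_pmul1g group_pmulg1 group_pmulA.

Fact group_pmulC a b : Some (a * b) = Some (b * a ^ b).
Proof. by rewrite -conjgC. Qed.
Fact group_qconjM a b c bc : Some (b * c) = Some bc -> a ^ bc = (a ^ b) ^ c.
Proof. by case=> <-; rewrite conjgM. Qed.
Fact group_pmulJ a b c :
  omap (fun x => x ^ c) (Some (a * b)) = Some (a ^ c * b ^ c).
Proof. by rewrite /= conjMg. Qed.

HB.instance Definition _ := Quandle_PartialMonoid_isPMQ.Build (group_pmq G)
  group_pmulC group_qconjM group_pmulJ.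

End GroupPMQ.

(* [pair_act g a] is r(g)(a); [pair_actM] is the homomorphism property of
   r : G -> Aut(Q)^op. *)
Record pmqGroupPair := PMQGroupPair {
  pair_pmq : pmqType;
  pair_group : groupType;
  pair_map : pair_pmq -> group_pmq pair_group;
  pair_act : pair_group -> pair_pmq -> pair_pmq;
  pair_mapP : is_pmq_map pair_map;
  pair_act_aut : forall g, is_pmq_aut (pair_act g);
  pair_act1 : forall a, pair_act 1 a = a;
  pair_actM : forall g h a, pair_act (g * h) a = pair_act h (pair_act g a);
  pair_act_map : forall a b, pair_act (pair_map b) a = qconj a b;
  pair_map_act : forall a g,
    pair_map (pair_act g a) = g^-1 * (pair_map a : pair_group) * g
}.

Record is_pmq_group_map (P P' : pmqGroupPair)
    (psi : pair_pmq P -> pair_pmq P') (phi : pair_group P -> pair_group P') :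
    Prop := IsPMQGroupMap {
  pair_map_pmq : is_pmq_map psi;
  pair_map_group : monoid_morphism phi;
  pair_map_comm : forall a, phi (pair_map a) = pair_map (psi a);
  pair_map_equiv : forall g a,
    psi (pair_act g a) = pair_act (phi g) (psi a)
}.

Section FreeGroup.
Variable T : choiceType.

(* The letter [(t, false)] is the generator t, [(t, true)] its inverse. *)
Definition letter : Type := (T * bool)%type.
Implicit Types (x y : letter) (u v w : seq letter).

Definition linv x : letter := (x.1, ~~ x.2).

Definition reduced w : bool := sorted (fun x y => y != linv x) w.

Definition push x w : seq letter :=
  if w is y :: w' then if y == linv x then w' else x :: w else [:: x].

(* The reduced form of [u ++ v], for [v] reduced. *)
Definition wmul u v : seq letter := foldr push v u.

Definition winv w : seq letter := rev (map linv w).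

Lemma linvK : involutive linv.
Proof. by case=> t b; rewrite /linv negbK. Qed.

Lemma push_reduced x w : reduced w -> reduced (push x w).
Proof.
case: w => [|y w] //= Hw; case: ifP => [_|/negbT Hy /=]; last by rewrite Hy.
by case: w Hw => //= z w /andP[].
Qed.

Lemma wmul_reduced u v : reduced v -> reduced (wmul u v).
Proof. by move=> Hv; elim: u => //= x u; apply: push_reduced. Qed.

Lemma push_linv x w : reduced w -> push x (push (linv x) w) = w.
Proof.
case: w => [|y w] /=; first by rewrite eqxx.
case: (y =P linv (linv x)) => [->|_ _] /=; last by rewrite eqxx.
by rewrite linvK; case: w => //= z w /andP[/negbTE ->].
Qed.

Lemma wmul_push x v w : reduced w ->
  wmul (push x v) w = push x (wmul v w).
Proof.
move=> Hw; case: v => //= y v; case: (y =P linv x) => [->|] //=.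
by rewrite push_linv // wmul_reduced.
Qed.

Lemma wmulA u v w : reduced w -> wmul u (wmul v w) = wmul (wmul u v) w.
Proof.
by move=> Hw; elim: u => //= x u ->; rewrite wmul_push.
Qed.

Lemma wmulw1 u : reduced u -> wmul u [::] = u.
Proof.
elim: u => //= x u IH Hxu; rewrite IH; last by case: u Hxu {IH} => //= ? ? /andP[].
by case: u Hxu {IH} => //= y u /andP[/negbTE ->].
Qed.

Lemma winv_reduced w : reduced w -> reduced (winv w).
Proof.
rewrite /reduced /winv rev_sorted sorted_map; apply: sub_sorted => x y; rewrite /relpre /=.
by apply: contraNneq => ->; rewrite linvK.
Qed.

Lemma winvK : involutive winv.
Proof. by move=> w; rewrite /winv map_rev revK mapK //; apply: linvK. Qed.

Lemma wmulV u : reduced u -> wmul u (winv u) = [::].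
Proof.
move=> Hu; rewrite -[winv u]wmulw1 ?winv_reduced //.
elim: u [::] {Hu} (isT : reduced [::]) => //= x u IH v Hv.
rewrite /winv /= rev_cons -cats1 /wmul foldr_cat /= -/(wmul _ _).
by rewrite (IH _ (push_reduced _ Hv)) push_linv.
Qed.

Record free_group : Type :=
  FreeGroup { fgword : seq letter; fgwordP : reduced fgword }.

HB.instance Definition _ := [isSub for fgword].
HB.instance Definition _ := [Choice of free_group by <:].

Definition fgone : free_group := @FreeGroup [::] isT.
Definition fginv (a : free_group) : free_group :=
  FreeGroup (winv_reduced (fgwordP a)).
Definition fgmul (a b : free_group) : free_group :=
  FreeGroup (wmul_reduced (fgword a) (fgwordP b)).

Fact fgmulA : associative fgmul.
Proof. by move=> a b c; apply/val_inj/wmulA/fgwordP. Qed.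
Fact fgmul1g : left_id fgone fgmul.
Proof. by move=> a; apply/val_inj. Qed.
Fact fgmulg1 : right_id fgone fgmul.
Proof. by move=> a; apply/val_inj/wmulw1/fgwordP. Qed.
Fact fgmulgV : right_inverse fgone fginv fgmul.
Proof. by move=> a; apply/val_inj/wmulV/fgwordP. Qed.
Fact fgmulVg : left_inverse fgone fginv fgmul.
Proof.
move=> a; apply/val_inj => /=; rewrite -[X in wmul _ X]winvK.
by apply/wmulV/winv_reduced/fgwordP.
Qed.

HB.instance Definition _ := isGroup.Build free_group
  fgmulA fgmul1g fgmulg1 fgmulVg fgmulgV.

Definition fgen (t : T) : free_group := @FreeGroup [:: (t, false)] isT.

Definition wdeg w : int := (\sum_(x <- w) (if x.2 then -1 else 1))%R.
Definition fgdeg (a : free_group) : int := wdeg (fgword a).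

Lemma fgdegM a b : fgdeg (a * b) = (fgdeg a + fgdeg b)%R.
Proof.
have pushE x w : wdeg (push x w) = ((if x.2 then -1 else 1) + wdeg w)%R.
  case: w => [|y w] /=; first by rewrite /wdeg big_seq1 big_nil GRing.addr0.
  case: eqP => [->|_]; rewrite /wdeg !big_cons //= GRing.addrA.
  by case: x.2; rewrite /= ?GRing.addNr ?GRing.subrr GRing.add0r.
rewrite /fgdeg /=; elim: (fgword a) => [|x u IH] /=.
  by rewrite /wdeg big_nil GRing.add0r.
by rewrite pushE IH [wdeg (x :: u)]big_cons GRing.addrA.
Qed.

Lemma fgdeg1 : fgdeg 1 = 0%R.
Proof. by rewrite /fgdeg /wdeg big_nil. Qed.

Lemma fgdegJ a b : fgdeg (a ^ b) = fgdeg a.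
Proof.
rewrite conjgE !fgdegM GRing.addrCA -fgdegM mulVg.
by rewrite fgdeg1 GRing.addr0.
Qed.

Lemma fgdeg_gen t : fgdeg (fgen t) = 1%R.
Proof. by rewrite /fgdeg /wdeg big_seq1. Qed.

End FreeGroup.

Section FQ.
Variables k l : nat.
Implicit Types x y g : free_group 'I_k.

Definition FQset : {pred free_group 'I_k} := fun x =>
  `[< x = 1 \/ exists (i : 'I_k) g, (i < l)%N /\ x = fgen i ^ g >].

Lemma FQset1 : 1 \in FQset.
Proof. by apply/asboolP; left. Qed.

Lemma FQsetJ x g : (x ^ g \in FQset) = (x \in FQset).
Proof.
suff H y h : y \in FQset -> y ^ h \in FQset.
  by apply/idP/idP => [/(H _ g^-1)|/H//]; rewrite conjgK.
case/asboolP => [->|[i [h' [il ->]]]]; apply/asboolP.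
  by left; rewrite conj1g.
by right; exists i, (h' * h); rewrite conjgM.
Qed.

Lemma FQset_deg x : x \in FQset -> x = 1 \/ fgdeg x = 1%R.
Proof.
case/asboolP => [->|[i [g [_ ->]]]]; [by left | right].
by rewrite fgdegJ fgdeg_gen.
Qed.

Lemma FQsetM x y :
  x \in FQset -> y \in FQset -> x * y \in FQset -> x = 1 \/ y = 1.
Proof.
case/FQset_deg => [->|dx]; first by left.
case/FQset_deg => [->|dy]; first by right.
by case/FQset_deg => [/(congr1 (@fgdeg _))|]; rewrite fgdegM dx dy ?fgdeg1.
Qed.

Record FQ : Type := MkFQ { FQval : free_group 'I_k; FQvalP : FQval \in FQset }.

HB.instance Definition _ := [isSub for FQval].
HB.instance Definition _ := [Choice of FQ by <:].

Lemma FQconj_subproof (a : FQ) g : FQval a ^ g \in FQset.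
Proof. by rewrite FQsetJ; apply: FQvalP. Qed.

Definition FQone : FQ := MkFQ FQset1.
Definition FQact g (a : FQ) : FQ := MkFQ (FQconj_subproof a g).
Definition FQconj (a b : FQ) : FQ := FQact (FQval b) a.
(* [insub x] is [Some] when x lies in [FQset], and [None] otherwise. *)
Definition FQmul (a b : FQ) : option FQ := insub (FQval a * FQval b).

HB.instance Definition _ := hasUnit.Build FQ FQone.

Fact FQconj_bij b : bijective (FQconj^~ b).
Proof.
exists (FQact (FQval b)^-1) => a; apply: val_inj => /=.
  by rewrite conjgK.
by rewrite conjgKV.
Qed.
Fact FQconj1q a : FQconj FQone a = FQone.
Proof. by apply: val_inj; rewrite /= conj1g. Qed.
Fact FQconjq1 a : FQconj a FQone = a.
Proof. by apply: val_inj; rewrite /= conjg1. Qed.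
Fact FQconjqq a : FQconj a a = a.
Proof. by apply: val_inj; rewrite /= conjgE mulKg. Qed.
Fact FQconjJ a b c : FQconj (FQconj a b) c = FQconj (FQconj a c) (FQconj b c).
Proof. by apply: val_inj; rewrite /= conjJg. Qed.

HB.instance Definition _ := isQuandle.Build FQ
  FQconj_bij FQconj1q FQconjq1 FQconjqq FQconjJ.

Fact FQmul1q a : FQmul FQone a = Some a.
Proof. by rewrite /FQmul mul1g valK. Qed.
Fact FQmulq1 a : FQmul a FQone = Some a.
Proof. by rewrite /FQmul mulg1 valK. Qed.

Lemma FQmul_None a b : a != FQone -> b != FQone -> FQmul a b = None.
Proof.
move=> a1 b1; rewrite /FQmul insubN //; apply/negP => ab.
have [e|e] := FQsetM (FQvalP a) (FQvalP b) ab.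
  by case/eqP: a1; apply: val_inj.
by case/eqP: b1; apply: val_inj.
Qed.

Fact FQmulA a b c :
  obind (fun ab => FQmul ab c) (FQmul a b)
  = obind (fun bc => FQmul a bc) (FQmul b c).
Proof.
have [->|a1] := eqVneq a FQone.
  by rewrite FQmul1q /=; case: (FQmul b c) => //= d; rewrite FQmul1q.
have [->|b1] := eqVneq b FQone; first by rewrite FQmulq1 FQmul1q.
have [->|c1] := eqVneq c FQone.
  by rewrite FQmulq1 /=; case: (FQmul a b) => //= d; rewrite FQmulq1.
by rewrite !FQmul_None.
Qed.

HB.instance Definition _ := isPartialMonoid.Build FQ FQmul1q FQmulq1 FQmulA.

Fact FQmulC a b : FQmul a b = FQmul b (FQconj a b).
Proof. by rewrite /FQmul /= -conjgC. Qed.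
Fact FQconjM a b c bc :
  FQmul b c = Some bc -> FQconj a bc = FQconj (FQconj a b) c.
Proof.
rewrite /FQmul; case: insubP => // d _ e [<-]; apply: val_inj => /=.
by rewrite -conjgM -e.
Qed.
Fact FQmulJ a b c : omap (FQconj^~ c) (FQmul a b) = FQmul (FQconj a c) (FQconj b c).
Proof.
rewrite /FQmul /= -conjMg; case: insubP => [d _ e|Hd] /=.
  by rewrite -e (_ : val d ^ _ = val (FQconj d c)) // valK.
by rewrite insubN // FQsetJ.
Qed.

HB.instance Definition _ := Quandle_PartialMonoid_isPMQ.Build FQ
  FQmulC FQconjM FQmulJ.

Definition FQincl (a : FQ) : group_pmq (free_group 'I_k) := FQval a.

Fact FQincl_map : is_pmq_map FQincl.
Proof.
split=> // a b c; rewrite /pmul /= /FQmul; case: insubP => // d _ e [<-].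
by rewrite /FQincl -[FQval d]/(val d) e.
Qed.

Fact FQact_map g : is_pmq_map (FQact g).
Proof.
split=> [|a b|a b c].
- by apply: val_inj; rewrite /= conj1g.
- by apply: val_inj; rewrite /= conjJg.
- rewrite /pmul /= /FQmul /= -conjMg; case: insubP => // d _ e [<-].
  by rewrite -e (_ : val d ^ _ = val (FQact g d)) // valK.
Qed.

Fact FQactK g : cancel (FQact g) (FQact g^-1).
Proof. by move=> a; apply: val_inj; rewrite /= conjgK. Qed.

Fact FQact_aut g : is_pmq_aut (FQact g).
Proof.
split; first exact: FQact_map.
exists (FQact g^-1); split; [exact: FQact_map | exact: FQactK |].
by move=> a; rewrite -{1}[g]invgK FQactK.
Qed.

Fact FQact1 a : FQact 1 a = a.
Proof. by apply: val_inj; rewrite /= conjg1. Qed.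
Fact FQactM g h a : FQact (g * h) a = FQact h (FQact g a).
Proof. by apply: val_inj; rewrite /= conjgM. Qed.
Fact FQact_incl a b : FQact (FQincl b) a = qconj a b.
Proof. by []. Qed.
Fact FQincl_act a g : FQincl (FQact g a) = g^-1 * FQval a * g.
Proof. by rewrite /FQincl /= conjgE mulgA. Qed.

Definition FQ_pair : pmqGroupPair :=
  PMQGroupPair FQincl_map FQact_aut FQact1 FQactM FQact_incl FQincl_act.

Lemma FQgen_subproof (i : {i : 'I_k | (i < l)%N}) : fgen (sval i) \in FQset.
Proof.
by apply/asboolP; right; exists (sval i), 1; rewrite conjg1; case: i.
Qed.

(* f_1, ..., f_k are numbered from 0: [fgen i] is f_(i+1). *)
Definition FQgen (i : {i : 'I_k | (i < l)%N}) : FQ := MkFQ (FQgen_subproof i).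

End FQ.

(* Main.v *)
(* [phi] is evaluation of words, and [psi] must send [f_i ^ h] to
   [r (phi h) (a_i)].  This is well defined: if [f_i ^ h = f_j ^ h'], then
   [h * h'^-1] conjugates [f_i] to [f_j], which forces [i = j] and makes it a
   power of [f_i], so that [phi (h * h'^-1)] is a power of [e a_i], and this
   fixes [a_i] because [a_i ^ a_i = a_i]. *)
Require Import Defs.
From mathcomp Require Import all_boot.
From mathcomp Require Import boolp.
From mathcomp Require Import monoid.

Set Implicit Arguments.
Unset Strict Implicit.
Unset Printing Implicit Defensive.

Local Open Scope group_scope.

Section FreeGroupTheory.
Variable T : choiceType.
Implicit Types (x : letter T) (u v w : seq (letter T)) (s t : T).
Implicit Types c : free_group T.

Lemma size_push x w : (size (push x w) <= (size w).+1)%N.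
Proof. by case: w => [|y w] //=; case: eqP => //= _; rewrite ltnW. Qed.

Lemma size_wmul u v : (size (wmul u v) <= size u + size v)%N.
Proof.
elim: u => //= x u IH.
by apply: leq_trans (size_push _ _) _; rewrite addSn ltnS.
Qed.

Lemma push_cons x w : reduced (x :: w) -> push x w = x :: w.
Proof. by case: w => //= y w /andP[/negbTE ->]. Qed.

Lemma reduced_behead x w : reduced (x :: w) -> reduced w.
Proof. by case: w => //= y w /andP[]. Qed.

Lemma fgen_neq1 t : fgen t <> 1.
Proof. by move/(congr1 (@fgword _)). Qed.

Lemma fgen_conj_neq1 t c : fgen t ^ c <> 1.
Proof. by move=> /eqP; rewrite conjg_eq1 => /eqP /fgen_neq1. Qed.

(** In the free group the hypothesis reads [s w = w t]. If [w] starts with [s] or its inverse, this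
    letter commutes with [s] and cancels on the left, leaving the same equation for the tail of [w].
    Comparing lengths excludes any other first letter. *)
Lemma wmul_gen_comm s t w : reduced w ->
  push (s, false) w = wmul w [:: (t, false)] ->
  s = t /\ all (fun x => x.1 == s) w.
Proof.
elim: w => [_ [->]//|x w IH rxw].
have rw := reduced_behead rxw.
have rwt : reduced (wmul w [:: (t, false)]) by exact: wmul_reduced.
rewrite /= -/(wmul w _).
have [->|xNs] := x =P linv (s, false).
  move=> Ew; have [] := IH rw.
    by rewrite {1}Ew -[(s, false) in LHS]linvK push_linv // linvK.
  by move=> -> ->; rewrite /= eqxx.
have [Ex|xNs'] := x =P (s, false).
  rewrite Ex in rxw *; move=> Ew.
  have [] := IH rw; last by move=> -> -> /=; rewrite eqxx.
  rewrite (push_cons rxw) -(push_linv (linv (s, false)) rwt) linvK -Ew.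
  by rewrite /= eqxx.
(* The left side is now [(s, false) :: x :: w]. The right side can start with [(s, false)] only if
   [x] cancels the head of [wmul w [:: (t, false)]], and then it has at most [size w] letters. *)
have := size_wmul w [:: (t, false)]; rewrite addn1.
case: (wmul w _) => [|y v] /= => [_ [/esym /xNs' //]|size_v].
case: ifP => [_ /(congr1 size) /= Ev|_ [/esym /xNs' //]].
by move: size_v; rewrite -Ev ltnNge ltnS => /negP; case; apply: leqnSn.
Qed.

(** The equation means [fgen s * c = c * fgen t]. The condition on letters is how [c] being a power
    of [fgen s] is expressed. *)
Lemma fgen_conj s t c : fgen s ^ c = fgen t ->
  s = t /\ all (fun x => x.1 == s) (fgword c).
Proof.
move=> E; apply: wmul_gen_comm (fgwordP c) _.
have /(congr1 (@fgword _)) //= : fgen s * c = c * fgen t.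
by rewrite -E -conjgC.
Qed.

Section Eval.
Variables (G : groupType) (h : T -> G).

Definition eval_letter x : G := if x.2 then (h x.1)^-1 else h x.1.
Definition eval_word w : G := foldr (fun x p => eval_letter x * p) 1 w.
Definition fgeval c : G := eval_word (fgword c).

Lemma eval_letterV x : eval_letter (linv x) = (eval_letter x)^-1.
Proof. by case: x => t [] //=; rewrite /eval_letter /= invgK. Qed.

(** Evaluation does not see reduction: [push] only cancels a letter against its inverse, and their
    values cancel in [G]. *)
Lemma eval_push x w : eval_word (push x w) = eval_letter x * eval_word w.
Proof.
case: w => [|y w] //=; case: eqP => // ->.
by rewrite eval_letterV mulVKg.
Qed.

Lemma fgeval_morph : monoid_morphism fgeval.
Proof.
split=> // b c; rewrite /fgeval /=.
elim: (fgword b) => [|x u IH] /=; first by rewrite mul1g.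
by rewrite eval_push IH mulgA.
Qed.

Lemma fgeval_gen t : fgeval (fgen t) = h t.
Proof. by rewrite /fgeval /= mulg1. Qed.

Lemma fgeval_unique (phi : free_group T -> G) :
  monoid_morphism phi -> (forall t, phi (fgen t) = h t) -> phi =1 fgeval.
Proof.
move=> [phi1 phiM] phi_gen [w rw]; rewrite /fgeval /=.
elim: w rw => [|x w IH] rxw.
  by rewrite -[RHS]phi1; congr phi; apply/val_inj.
have rw := reduced_behead rxw; rewrite /= -(IH rw).
(* A reduced word is the product of its first letter and its tail, since [push] cancels nothing
   there. *)
have -> : FreeGroup rxw =
    (if x.2 then (fgen x.1)^-1 else fgen x.1) * FreeGroup rw.
  by apply: val_inj; rewrite -[LHS](push_cons rxw); case: x {rxw} => t [].
rewrite phiM /eval_letter; case: x.2; rewrite -phi_gen //; congr (_ * _).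
(* A [monoid_morphism] provides only unit and products; inverses follow from these. *)
by apply/eqP; rewrite -mulg_eq1 -phiM mulVg phi1.
Qed.

End Eval.

End FreeGroupTheory.

Section PairAct.
Variable P : pmqGroupPair.

Lemma pair_act_unit h : pair_act h qunit = qunit :> pair_pmq P.
Proof. exact: pmq_map1 (pair_act_aut h).1. Qed.

Lemma pair_act_map_self (b : pair_pmq P) : pair_act (pair_map b) b = b.
Proof. by rewrite pair_act_map qconjqq. Qed.

Lemma pair_act_map_selfV (b : pair_pmq P) :
  pair_act (pair_map b : pair_group P)^-1 b = b.
Proof.
by rewrite -{2}(pair_act_map_self b) -pair_actM mulgV pair_act1.
Qed.

Variables (T : choiceType) (h : T -> pair_group P).

(** Each letter of [w] evaluates to [pair_map b] or its inverse, and both fix [b]. *)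
Lemma pair_act_eval_fix (t : T) (b : pair_pmq P) w :
  h t = pair_map b -> all (fun x => x.1 == t) w ->
  pair_act (eval_word h w) b = b.
Proof.
move=> ht; elim: w => [_|[s e] w IH /= /andP[/eqP -> /IH {}IH]].
  exact: pair_act1.
rewrite pair_actM /eval_letter /= ht.
by case: e; rewrite ?pair_act_map_self ?pair_act_map_selfV.
Qed.

End PairAct.

Section Extension.
Variables (k l : nat) (P : pmqGroupPair).
Variable a : {i : 'I_k | (i < l)%N} -> pair_pmq P.
Variable g : {i : 'I_k | (l <= i)%N} -> pair_group P.
Implicit Types (x y : FQ k l) (c d : free_group 'I_k).

(* The last branch is never reached. *)
Definition gen_image (i : 'I_k) : pair_group P :=
  if insub i is Some j then pair_map (a j)
  else if insub i is Some j then g j else 1.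

Lemma gen_image_lt j : gen_image (sval j) = pair_map (a j).
Proof. by rewrite /gen_image -[sval j]/(val j) valK. Qed.

Lemma gen_image_ge j : gen_image (sval j) = g j.
Proof.
rewrite /gen_image insubN -?leqNgt ?(valP j) //.
by rewrite -[sval j]/(val j) valK.
Qed.

Let phi := fgeval gen_image.
Let phiM : {morph phi : c d / c * d} := (fgeval_morph gen_image).2.

Lemma FQ_case x : x = FQone k l \/ exists i c, x = FQact c (FQgen i).
Proof.
case: x => x xP; case/asboolP: (xP) => [x1|[i [c [il xE]]]].
  by left; apply: val_inj.
by right; exists (exist _ i il), c; apply: val_inj.
Qed.

Lemma FQact_gen_inj i j c d :
  FQact c (FQgen i) = FQact d (FQgen j) :> FQ k l ->
  pair_act (phi c) (a i) = pair_act (phi d) (a j).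
Proof.
move=> /(congr1 val) /= E.
have /fgen_conj[ij wi] : fgen (sval i) ^ (c * d^-1) = fgen (sval j).
  by rewrite conjgM E conjgK.
have {}ij : i = j by apply: val_inj.
(* In [c = (c * d^-1) * d] the left factor acts first, and it fixes [a i]. *)
rewrite -ij -[c](mulgVK d) phiM pair_actM; congr pair_act.
exact: pair_act_eval_fix (gen_image_lt i) wi.
Qed.

Lemma psi_exists : exists psi : FQ k l -> pair_pmq P,
  psi qunit = qunit /\
  forall i c, psi (FQact c (FQgen i)) = pair_act (phi c) (a i).
Proof.
have gen_neq1 i c : FQact c (FQgen i) <> FQone k l.
  by move=> /(congr1 val) /= /fgen_conj_neq1.
(* An element has many presentations [FQact c (FQgen i)]; [R] constrains the value through all of
   them at once, so any choice function for [R] is the required map. *)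
pose R x (b : pair_pmq P) :=
  (x = qunit -> b = qunit) /\
  forall i c, x = FQact c (FQgen i) -> b = pair_act (phi c) (a i).
have [psi psiP] : {psi & forall x, R x (psi x)}.
  apply: choice => x; case: (FQ_case x) => [->|[i [c ->]]].
    by exists qunit; split=> // i c /esym /gen_neq1.
  exists (pair_act (phi c) (a i)); split=> [/gen_neq1 //|j d].
  exact: FQact_gen_inj.
by exists psi; split=> [|i c]; [apply: (psiP _).1 | apply: (psiP _).2].
Qed.

End Extension.

Theorem theorem2 (k l : nat) (hlk : (l <= k)%N) (P : pmqGroupPair)
  (a : {i : 'I_k | (i < l)%N} -> pair_pmq P)
  (g : {i : 'I_k | (l <= i)%N} -> pair_group P) :
  exists! m : (FQ k l -> pair_pmq P) * (free_group 'I_k -> pair_group P),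
    let: (psi, phi) := m in
    [/\ is_pmq_map psi,
        monoid_morphism phi,
        forall i, psi (FQgen i) = a i,
        forall i, phi (fgen (sval i)) = g i
      & @is_pmq_group_map (FQ_pair k l) P psi phi].
Proof.
set h := gen_image a g; pose phi := fgeval h.
have phiP : monoid_morphism phi := fgeval_morph h.
have [psi [psi1 psi_gen]] := psi_exists a g.
rewrite -/h -/phi in psi_gen.
have psi_act c x : psi (FQact c x) = pair_act (phi c) (psi x).
  case: (FQ_case x) => [->|[i [d ->]]].
    by rewrite (pmq_map1 (FQact_map l c)) psi1 pair_act_unit.
  by rewrite -FQactM !psi_gen phiP.2 pair_actM.
have psi_fgen i : psi (FQgen i) = a i.
  by rewrite -[FQgen i]FQact1 psi_gen phiP.1 pair_act1.
(* Equivariance reduces this to the generators, where [h] was chosen to make it true. *)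
have phi_psi x : phi (FQval x) = pair_map (psi x).
  case: (FQ_case x) => [->|[i [c ->]]].
    by rewrite psi1 (pmq_map1 (pair_mapP P)) phiP.1.
  rewrite psi_act psi_fgen pair_map_act /= conjgE !phiP.2.
  have -> : phi c^-1 = (phi c)^-1.
    by apply/eqP; rewrite -mulg_eq1 -phiP.2 mulVg phiP.1.
  by rewrite /phi fgeval_gen /h gen_image_lt mulgA.
have psiP : is_pmq_map psi.
  (* Conjugation by [y] is the action of [FQval y], hence a case of [psi_act]. *)
  split=> // [x y|x y z]; first by rewrite psi_act phi_psi pair_act_map.
  (* A product in [FQ k l] is defined only when one factor is the unit. *)
  have [->|x1] := eqVneq x (FQone k l); first by rewrite psi1 !pmul1q => -[->].
  have [->|y1] := eqVneq y (FQone k l); first by rewrite psi1 !pmulq1 => -[->].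
  by rewrite [pmul x y]FQmul_None.
exists (psi, phi); split.
  split=> // i; by rewrite /phi fgeval_gen /h gen_image_ge.
move=> [psi' phi'] [psi'P phi'P psi'_gen phi'_gen [_ _ comm equiv]].
have phiE : phi' = phi.
  apply/funext/fgeval_unique => // i; case: (ltnP i l) => il.
    (* For [i < l], [comm] forces [phi' (fgen i)] to be the image of [a i] under [pair_map]. *)
    have -> : i = sval (exist (fun i : 'I_k => i < l)%N i il) by [].
    by rewrite /h gen_image_lt -psi'_gen -comm.
  have -> : i = sval (exist (fun i : 'I_k => l <= i)%N i il) by [].
  by rewrite /h gen_image_ge.
congr pair => //; apply/funext => x.
case: (FQ_case x) => [->|[i [c ->]]]; first by rewrite psi1 (pmq_map1 psi'P).
(* Equivariance determines [psi'] on conjugates from its values on generators. *)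
by rewrite psi_gen (equiv c (FQgen i)) psi'_gen phiE.
Qed.
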